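(* Let $f\in\mathcal{S}^{1,1}_{\mu,L}(\mathbb{R}^n)$ and $g\in\Gamma_0(\mathbb{R}^n)$, let $\varphi:=f+g$, and assume that the set $X^*$ of minimizers of $\varphi$ over $\mathbb{R}^n$ is nonempty, with minimal value $\bar\varphi$; let $x^*\in X^*$. Let $(B_k)_{k\geq0}$ be positive scalars, let $b_0=B_0$ and $b_k=B_k-B_{k-1}$ for $k\geq1$, and let $(a_k)_{k\geq0}$ be scalars, with $a_k,b_k\geq0$ and $$a_k\leq\frac{B_k-b_k^2}{2L}\qquad\text{for all }k\geq1.$$ Let $x^0\in\mathbb{R}^n$ be arbitrary, $v^0=x^0$, and let $\{x^k\},\{y^k\},\{v^k\}$ be generated by, for $k\geq1$, $$y^{k-1}=x^{k-1}-\frac1L\mathcal{G}(x^{k-1}),\qquad v^k=v^{k-1}-\frac{b_{k-1}}{L}\mathcal{G}(x^{k-1}),\qquad x^k=\frac{B_{k-1}}{B_k}y^{k-1}+\frac{b_k}{B_k}v^k.$$ Denote $$\tilde{\mathcal{C}}:=a_0\|\mathcal{G}(x^0)\|^2+b_0(\varphi(y^0)-\bar\varphi)+\frac L2\|x^*-v^0\|^2.$$ Then for all $k\geq1$, $$\varphi(y^k)-\bar\varphi\leq\frac{\tilde{\mathcal{C}}}{B_k}\qquad\text{and}\qquad\sum_{i=0}^{k}a_i\|\mathcal{G}(x^i)\|^2\leq\tilde{\mathcal{C}}.$$ In particular, if $b_k=\frac14(k+1)$, $B_k=\frac18(k+1)(k+2)$ and $a_k=\frac{1}{32L}(k+1)^2$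 for $k\geq1$, then for all $k\geq1$, $$\varphi(y^k)-\bar\varphi\leq\frac{8\tilde{\mathcal{C}}}{(k+1)(k+2)}\qquad\text{and}\qquad\min_{0\leq i\leq k}\|\mathcal{G}(x^i)\|^2\leq\frac{192L\,\tilde{\mathcal{C}}}{(k+1)(k+2)(k+3)}.$$
   Context: Constants $L>0$ and $\mu\geq 0$. $\mathcal{S}^{1,1}_{\mu,L}(\mathbb{R}^n)$ is the class of differentiable functions $f:\mathbb{R}^n\to\mathbb{R}$ that are $L$-smooth and $\mu$-strongly convex, i.e. for all $x,y\in\mathbb{R}^n$: $f(y)\leq f(x)+\langle\nabla f(x),y-x\rangle+\frac{L}{2}\|y-x\|^2$ and $f(y)\geq f(x)+\langle\nabla f(x),y-x\rangle+\frac{\mu}{2}\|y-x\|^2$. $\Gamma_0(\mathbb{R}^n)$ is the class of proper closed convex functions $\mathbb{R}^n\to(-\infty,+\infty]$. The norm is the one induced by the inner product $\langle\cdot,\cdot\rangle$. The proximal mapping is $\mathbf{prox}_{tg}(x):=\arg\min_{y\in\mathbb{R}^n}\{g(y)+\frac{1}{2t}\|y-x\|^2\}$, and the proximal gradient mapping is $\mathcal{G}(x,t):=t^{-1}\left(x-\mathbf{prox}_{tg}(x-t\nabla f(x))\right)$ for $t>0$. The abbreviation $\mathcal{G}(x):=\mathcal{G}(x,\frac1L)$ is used.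
   Formalization: The two general estimates are stated under the extra assumption B_0 ≤ 1; without it they fail (e.g. L=1, f=0, g=|·|, x^0=1, B_0=100, B_k=110 for k≥1, a_1=5, other a_k=0). The ''in particular'' part needs no such assumption, since there B_0=1/4. *)

(* Defs.v *)
From HB Require Import structures.
From mathcomp Require Import all_boot all_order all_algebra.
From mathcomp Require Import all_classical all_reals all_analysis.

Set Implicit Arguments.
Unset Strict Implicit.
Unset Printing Implicit Defensive.

Import Order.TTheory GRing.Theory Num.Theory.
Import numFieldNormedType.Exports.

Local Open Scope classical_set_scope.
Local Open Scope ring_scope.

(* The library norm `|x| on 'rV[R]_n is the sup norm, hence the Euclidean
   inner product and norm below.  Both norms induce the same topology, so
   [differentiable] and [closed] are the usual notions. *)
Definition inner (R : realType) (n : nat) (x y : 'rV[R]_n) : R :=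
  \sum_(i < n) x 0 i * y 0 i.

Definition enorm (R : realType) (n : nat) (x : 'rV[R]_n) : R :=
  Num.sqrt (inner x x).

Definition grad (R : realType) (n : nat) (f : 'rV[R]_n -> R) (x : 'rV[R]_n) :
    'rV[R]_n :=
  \row_(j < n) 'D_(delta_mx 0 j) f x.

Definition smooth_strongly_convex (R : realType) (n : nat) (mu L : R)
    (f : 'rV[R]_n -> R) : Prop :=
  [/\ forall x, differentiable f x,
      forall x y, f y <= f x + inner (grad f x) (y - x)
                         + L / 2 * enorm (y - x) ^+ 2
    & forall x y, f x + inner (grad f x) (y - x)
                  + mu / 2 * enorm (y - x) ^+ 2 <= f y].

Definition proper_fun (R : realType) (n : nat) (g : 'rV[R]_n -> \bar R) : Prop :=
  (forall x, g x <> -oo%E) /\ (exists x, g x <> +oo%E).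

Definition epigraph (R : realType) (n : nat) (g : 'rV[R]_n -> \bar R) :
    set ('rV[R]_n * R) :=
  [set p | (g p.1 <= p.2%:E)%E].

Definition closed_fun (R : realType) (n : nat) (g : 'rV[R]_n -> \bar R) : Prop :=
  closed (epigraph g).

Definition convex_fun (R : realType) (n : nat) (g : 'rV[R]_n -> \bar R) : Prop :=
  forall (x y : 'rV[R]_n) (t : R), 0 < t < 1 ->
    (g (t *: x + (1 - t) *: y)%R <= t%:E * g x + (1 - t)%:E * g y)%E.

Definition Gamma0 (R : realType) (n : nat) (g : 'rV[R]_n -> \bar R) : Prop :=
  [/\ proper_fun g, closed_fun g & convex_fun g].

Definition argmin (R : realType) (n : nat) (h : 'rV[R]_n -> \bar R) :
    set 'rV[R]_n :=
  [set y | forall z, (h y <= h z)%E].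

Definition min_value (R : realType) (n : nat) (h : 'rV[R]_n -> \bar R) : \bar R :=
  ereal_inf (range h).

(* For g in Gamma0 and 0 < t the set of minimizers is a singleton, so the
   default value of [xget] plays no role. *)
Definition prox (R : realType) (n : nat) (t : R) (g : 'rV[R]_n -> \bar R)
    (x : 'rV[R]_n) : 'rV[R]_n :=
  xget 0 (argmin (fun y => g y + ((2 * t)^-1 * enorm (y - x) ^+ 2)%:E)%E).

Definition prox_grad_map (R : realType) (n : nat) (f : 'rV[R]_n -> R)
    (g : 'rV[R]_n -> \bar R) (x : 'rV[R]_n) (t : R) : 'rV[R]_n :=
  t^-1 *: (x - prox t g (x - t *: grad f x)).

Definition composite (R : realType) (n : nat) (f : 'rV[R]_n -> R)
    (g : 'rV[R]_n -> \bar R) (x : 'rV[R]_n) : \bar R :=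
  ((f x)%:E + g x)%E.

(* Main.v *)
(** Write [G_k] for the proximal gradient at [x_k].  Optimality of the proximal
    point [y_k], smoothness and convexity of [f] give, for all [z],
      [phi (y_k) <= phi z + <G_k, x_k - z> - |G_k|^2 / (2 L)].
    Weighting the cases [z = y_(k-1)] and [z = x^*] by [B_(k-1)] and [b_k], the
    recursions for [x_k] and [v_(k+1)] make all inner products cancel, so that
      [\sum_(i <= k) a_i |G_i|^2 + B_k (phi (y_k) - phibar)
         + L / 2 |x^* - v_(k+1)|^2]
    is nonincreasing in [k].  At [k = 0] it is at most [C] because
    [b_0 = B_0 <= 1]. *)
Require Import Defs.
From HB Require Import structures.
From mathcomp Require Import all_boot all_order all_algebra.
From mathcomp Require Import all_classical all_reals all_analysis.
From mathcomp Require Import ring lra.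

Import Order.TTheory GRing.Theory Num.Theory.
Import numFieldNormedType.Exports.

Local Open Scope classical_set_scope.
Local Open Scope ring_scope.

Set Implicit Arguments.
Unset Strict Implicit.

(** * Euclidean inner product and norm *)

Lemma innerC (R : realType) (n : nat) (x y : 'rV[R]_n) :
  inner x y = inner y x.
Proof. by apply: eq_bigr => i _; rewrite mulrC. Qed.

Lemma innerDl (R : realType) (n : nat) (x y z : 'rV[R]_n) :
  inner (x + y) z = inner x z + inner y z.
Proof.
by rewrite /inner -big_split; apply: eq_bigr => i _; rewrite mxE mulrDl.
Qed.

Lemma innerZl (R : realType) (n : nat) (c : R) (x z : 'rV[R]_n) :
  inner (c *: x) z = c * inner x z.
Proof.
by rewrite /inner mulr_sumr; apply: eq_bigr => i _; rewrite mxE mulrA.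
Qed.

Lemma innerDr (R : realType) (n : nat) (x y z : 'rV[R]_n) :
  inner x (y + z) = inner x y + inner x z.
Proof. by rewrite innerC innerDl !(innerC x). Qed.

Lemma innerZr (R : realType) (n : nat) (c : R) (x z : 'rV[R]_n) :
  inner x (c *: z) = c * inner x z.
Proof. by rewrite innerC innerZl innerC. Qed.

Lemma innerNl (R : realType) (n : nat) (x z : 'rV[R]_n) :
  inner (- x) z = - inner x z.
Proof. by rewrite -scaleN1r innerZl mulN1r. Qed.

Lemma innerNr (R : realType) (n : nat) (x z : 'rV[R]_n) :
  inner x (- z) = - inner x z.
Proof. by rewrite innerC innerNl innerC. Qed.

Definition innerE := (innerDl, innerDr, innerNl, innerNr, innerZl, innerZr).

Lemma inner_ge0 (R : realType) (n : nat) (x : 'rV[R]_n) : 0 <= inner x x.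
Proof. by apply: sumr_ge0 => i _; rewrite -expr2 sqr_ge0. Qed.

Lemma sqr_enorm (R : realType) (n : nat) (x : 'rV[R]_n) :
  enorm x ^+ 2 = inner x x.
Proof. by rewrite sqr_sqrtr // inner_ge0. Qed.

Lemma sqr_coord_le_inner (R : realType) (n : nat) (x : 'rV[R]_n) (i : 'I_n) :
  x 0 i ^+ 2 <= inner x x.
Proof.
rewrite /inner (bigD1 i) //= -expr2 lerDl.
by apply: sumr_ge0 => j _; rewrite -expr2 sqr_ge0.
Qed.

(** The last term is the exact convexity defect of the squared distance. It serves at midpoints for
    the Cauchy estimate and along a whole segment for optimality of the proximal point. *)
Lemma sqr_enorm_conv (R : realType) (n : nat) (t : R) (x y w : 'rV[R]_n) :
  enorm (t *: x + (1 - t) *: y - w) ^+ 2 =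
  t * enorm (x - w) ^+ 2 + (1 - t) * enorm (y - w) ^+ 2
  - t * (1 - t) * enorm (x - y) ^+ 2.
Proof.
rewrite !sqr_enorm !innerE (innerC y x) (innerC w x) (innerC w y).
ring.
Qed.

(** * Euclidean convergence and minimizers of the proximal objective *)

Lemma cvg_sqr_enorm (R : realType) (n : nat) (u : nat -> 'rV[R]_n)
    (l w : 'rV[R]_n) :
  u k @[k --> \oo] --> l ->
  enorm (u k - w) ^+ 2 @[k --> \oo] --> enorm (l - w) ^+ 2.
Proof.
move=> ul; under eq_fun do rewrite sqr_enorm.
rewrite sqr_enorm /inner.
apply: (@cvg_big _ _ _ _ _ (@add_continuous R) _ _ _
  (fun i k => (u k - w) 0 i * (u k - w) 0 i)) => i _.
have ui : (u k - w) 0 i @[k --> \oo] --> (l - w) 0 i.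
  under eq_fun do rewrite !mxE.
  rewrite !mxE; apply: cvgB; last exact: cvg_cst.
  apply: (cvg_comp _ (fun M : 'rV[R]_n => M 0 i) ul).
  exact: coord_continuous.
exact: cvgM.
Qed.

(** Balls are those of the sup norm, so each coordinate is bounded by the Euclidean norm and
    compared with the radius after squaring. *)
Lemma cvg_of_sqr_enorm_le (R : realType) (n : nat) (c : R)
    (u : nat -> 'rV[R]_n) :
  (forall j k, (j <= k)%N -> enorm (u j - u k) ^+ 2 <= c * j.+1%:R^-1) ->
  cvg (u k @[k --> \oo]).
Proof.
move=> hu; apply: cauchy_cvg; apply: cauchy_exP => e e0.
have [N _ hN] : \forall j \near \oo, c * harmonic j < e ^+ 2.
  have : c * harmonic j @[j --> \oo] --> c * (0 : R).
    by apply: cvgM; [exact: cvg_cst|exact: cvg_harmonic].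
  rewrite mulr0 => /cvgr_lt; apply; exact: exprn_gt0.
exists (u N); exists N => // k /= Nk; split => // i j.
rewrite (ord1 i) -ball_normE /=.
rewrite -(@ltr_pXn2r _ 2) ?nnegrE ?normr_ge0 ?(ltW e0)//.
rewrite real_normK ?num_real//.
have := sqr_coord_le_inner (u N - u k) j.
rewrite -sqr_enorm !mxE => /le_lt_trans; apply.
by apply: le_lt_trans (hu _ _ Nk) _; exact: (hN N (leqnn N)).
Qed.

(* Strong convexity makes every minimizing sequence Cauchy, which yields the
   minimizer without a coercivity argument. *)
Lemma prox_objective_argmin (R : realType) (n : nat) (g : 'rV[R]_n -> \bar R)
    (w : 'rV[R]_n) (c m0 : R) :
  Gamma0 g -> 0 < c ->
  (forall z, (m0%:E <= g z + (c * enorm (z - w) ^+ 2)%:E)%E) ->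
  exists z, argmin (fun z => g z + (c * enorm (z - w) ^+ 2)%:E)%E z.
Proof.
move=> [[gNy [z0 gz0]] gcl gcvx] c0 hm0.
(* Real heights above the objective at some point: their infimum is the minimal value, taken in [R]
   although [g] may be infinite. *)
pose V := [set s : R | exists z,
  (g z <= (s - c * enorm (z - w) ^+ 2)%:E)%E].
have Vlb : has_lbound V.
  exists m0 => s [z hz]; rewrite -lee_fin (le_trans (hm0 z))//.
  by rewrite -leeBrDr// -EFinB.
have V0 : V !=set0.
  exists (fine (g z0) + c * enorm (z0 - w) ^+ 2); exists z0.
  rewrite addrK fineK// fin_numE; apply/andP; split; apply/eqP.
    exact: gNy.
  exact: gz0.
have : forall k : nat, exists p : 'rV[R]_n * R,
    (g p.1 <= (p.2 - c * enorm (p.1 - w) ^+ 2)%:E)%E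
    /\ p.2 < inf V + k.+1%:R^-1.
  move=> k; have k0 : 0 < k.+1%:R^-1 :> R by rewrite invr_gt0.
  by have [s [z hz] sk] := inf_adherent k0 (conj V0 Vlb); exists (z, s).
move=> /choice[p hp].
pose u k := (p k).1; pose s k := (p k).2.
have hg k : (g (u k) <= (s k - c * enorm (u k - w) ^+ 2)%:E)%E := (hp k).1.
have hs k : s k < inf V + k.+1%:R^-1 := (hp k).2.
have sinf k : inf V <= s k by apply: ge_inf => //; exists (u k); exact: hg.
have hu : forall j k, (j <= k)%N ->
    enorm (u j - u k) ^+ 2 <= 4 / c * j.+1%:R^-1.
  move=> j k jk.
  (* The midpoint beats the average height by [c / 4] times the squared distance, and both heights
     are within [1 / (j + 1)] of [inf V]; hence the constant [4 / c]. *)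
  have : inf V <= (s j + s k) / 2 - c / 4 * enorm (u j - u k) ^+ 2.
    apply: ge_inf => //; exists (2^-1 *: u j + (1 - 2^-1) *: u k).
    apply: (le_trans (gcvx _ _ _ _)); first by apply/andP; split; lra.
    apply: (@le_trans _ _
      ((2^-1)%:E * (s j - c * enorm (u j - w) ^+ 2)%:E
       + (1 - 2^-1)%:E * (s k - c * enorm (u k - w) ^+ 2)%:E)%E).
      by apply: leeD; apply: lee_wpmul2l => //; rewrite lee_fin; lra.
    rewrite -!EFinM -EFinD lee_fin sqr_enorm_conv.
    lra.
  have kj : k.+1%:R^-1 <= j.+1%:R^-1 :> R by rewrite lef_pV2 ?posrE// ler_nat.
  move=> hi; rewrite mulrAC ler_pdivlMr // [_ * c]mulrC.
  move: (hs j) (hs k) kj hi; rewrite [c / 4 * _]mulrAC.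
  move: (c * _) (j.+1%:R^-1) (k.+1%:R^-1) => E ej ek.
  lra.
have ucvg := cvg_of_sqr_enorm_le hu.
set l := lim (u k @[k --> \oo]) in ucvg.
have scvg : s k @[k --> \oo] --> inf V.
  apply: (@squeeze_cvgr _ _ _ _ (fun=> inf V) (fun k => inf V + k.+1%:R^-1)).
  - by apply: nearW => k; rewrite sinf /= ltW// hs.
  - exact: cvg_cst.
  - rewrite -[X in _ --> X]addr0; apply: cvgD; first exact: cvg_cst.
    exact: cvg_harmonic.
exists l => z.
have rcvg : s k - c * enorm (u k - w) ^+ 2 @[k --> \oo]
    --> inf V - c * enorm (l - w) ^+ 2.
  apply: cvgB => //; apply: cvgM; first exact: cvg_cst.
  exact: cvg_sqr_enorm.
(* Lower semicontinuity of [g] in the form of its closed epigraph: the shifted heights converge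
   together with the points [u k]. *)
have gl : (g l <= (inf V - c * enorm (l - w) ^+ 2)%:E)%E.
  apply: (@closed_cvg _ _ _ eventually_filter
    (fun k => (u k, s k - c * enorm (u k - w) ^+ 2)) (epigraph g) gcl _
    (l, inf V - c * enorm (l - w) ^+ 2)).
    by apply: nearW => k; exact: hg.
  by move=> P; exact: (@cvg_pair _ _ _ _ (nbhs l) (nbhs _) _ _ _ _ _ ucvg rcvg).
apply: (@le_trans _ _ (inf V)%:E); first by rewrite -leeBrDr// -EFinB.
case E : (g z) => [r| |] /=; last 2 first.
- by rewrite addye// leey.
- by case: (gNy z).
rewrite -EFinD lee_fin; apply: ge_inf => //; exists z.
by rewrite addrK E.
Qed.

(** Minimality against [t *: z + (1 - t) *: y], divided by [t], gives the bound with the extra term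
    scaled by [1 - t]; a small explicit [t] replaces the limit at 0. *)
Lemma prox_objective_ineq (R : realType) (n : nat) (g : 'rV[R]_n -> \bar R)
    (w y z : 'rV[R]_n) (c r s : R) :
  convex_fun g -> 0 <= c ->
  argmin (fun z => g z + (c * enorm (z - w) ^+ 2)%:E)%E y ->
  g y = r%:E -> g z = s%:E ->
  r + c * enorm (y - w) ^+ 2 + c * enorm (z - y) ^+ 2
    <= s + c * enorm (z - w) ^+ 2.
Proof.
move=> gcvx c0 ymin gy gz.
set Y := c * enorm (y - w) ^+ 2; set Z := c * enorm (z - w) ^+ 2.
set D := c * enorm (z - y) ^+ 2.
have D0 : 0 <= D by rewrite mulr_ge0// sqr_ge0.
have key t : 0 < t < 1 -> (1 - t) * D <= s + Z - (r + Y).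
  move=> t01; have /andP[t0 t1] := t01.
  have := ymin (t *: z + (1 - t) *: y).
  have := gcvx z y t t01; rewrite gy gz -!EFinM -EFinD => h1 h2.
  have {h1 h2} := le_trans h2 (leeD2r _ h1).
  rewrite -!EFinD lee_fin sqr_enorm_conv -/Y => h.
  rewrite -(ler_pM2l t0) -subr_ge0; move: h; rewrite -subr_ge0.
  congr (is_true (0 <= _)); rewrite /Y /Z /D.
  by ring.
have half : (1 - 2^-1) * D <= s + Z - (r + Y).
  by apply: key; apply/andP; split; lra.
rewrite leNgt; apply/negP => lt.
have Dpos : 0 < D by lra.
(* If the bound failed, this [t] would place [(1 - t) * D] halfway between [D] and the smaller
   [s + Z - (r + Y)], against [key]; [half] ensures [t < 1]. *)
pose t := (D - (s + Z - (r + Y))) / (2 * D).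
have tD : t * D = (D - (s + Z - (r + Y))) / 2.
  by rewrite /t; field; rewrite gt_eqF.
have t0 : 0 < t by rewrite divr_gt0//; lra.
have t1 : t < 1 by rewrite ltr_pdivrMr//; lra.
have := key t; rewrite t0 t1 mulrBl tD => /(_ isT).
lra.
Qed.

(** * The proximal gradient step *)

Lemma min_value_argmin (R : realType) (n : nat) (h : 'rV[R]_n -> \bar R)
    (xs : 'rV[R]_n) :
  argmin h xs -> min_value h = h xs.
Proof.
move=> hxs; apply/eqP; rewrite eq_le; apply/andP; split.
  by apply: ereal_inf_lbound; exists xs.
by apply/ereal_infP => _ [z _ <-]; exact: hxs.
Qed.

Lemma fin_num_argmin_composite (R : realType) (n : nat) (f : 'rV[R]_n -> R)
    (g : 'rV[R]_n -> \bar R) (xs : 'rV[R]_n) :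
  proper_fun g -> argmin (composite f g) xs -> g xs \is a fin_num.
Proof.
move=> [gNy [z gz]] /(_ z); rewrite /composite fin_numE.
move: (gNy xs) (gNy z) gz.
by case: (g xs) => [r| |]; case: (g z) => [s| |].
Qed.

(** Up to a constant, the proximal objective is [g] plus the quadratic model of [f] at [x]. Its
    optimality inequality is combined with the upper model of [f] at [y] and the lower one at
    [z]. *)
Lemma prox_grad_step (R : realType) (n : nat) (mu L : R)
    (f : 'rV[R]_n -> R) (g : 'rV[R]_n -> \bar R) (xs x : 'rV[R]_n) :
  0 < L -> 0 <= mu -> smooth_strongly_convex mu L f -> Gamma0 g ->
  argmin (composite f g) xs ->
  let G := prox_grad_map f g x L^-1 in
  let y := x - L^-1 *: G in
  exists2 r, g y = r%:E & forall z s, g z = s%:E ->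
    f y + r <= f z + s + inner G (x - z) - (2 * L)^-1 * enorm G ^+ 2.
Proof.
move=> L0 mu0 [_ fL fmu] gG xsmin G y.
have [gpr gcl gcvx] := gG.
have [gNy _] := gpr.
have gxs := fin_num_argmin_composite gpr xsmin.
set d := grad f x in G y *.
pose w := x - L^-1 *: d.
pose c := (2 * L^-1)^-1.
have Ln0 : L != 0 by rewrite gt_eqF.
have cE : c = L / 2 by rewrite /c; field.
have c0 : 0 < c by rewrite cE divr_gt0.
have wE z : c * enorm (z - w) ^+ 2 = L / 2 * enorm (z - x) ^+ 2
    + inner d (z - x) + (2 * L)^-1 * enorm d ^+ 2.
  rewrite cE (_ : z - w = (z - x) + L^-1 *: d); last first.
    by rewrite /w opprB addrCA addrC.
  rewrite !sqr_enorm; move: (z - x) => e.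
  rewrite !innerE (innerC e d).
  by field.
(* Smoothness puts [f] below its quadratic model, so the minimum of [composite f g] bounds the
   proximal objective from below. A minimizer then exists, and [xget] returns one. *)
have lb z : (((f xs + fine (g xs)) - f x + (2 * L)^-1 * enorm d ^+ 2)%:E
    <= g z + (c * enorm (z - w) ^+ 2)%:E)%E.
  have := xsmin z; rewrite /composite -(fineK gxs).
  case E : (g z) => [s| |]; last by case: (gNy z).
    rewrite -!EFinD !lee_fin wE; have := fL x z; rewrite -/d.
    lra.
  by move=> _; rewrite addye ?leey.
have [p pmin] := prox_objective_argmin gG c0 lb.
have ymin : argmin (fun z => g z + (c * enorm (z - w) ^+ 2)%:E)%E y.
  rewrite (_ : y = prox L^-1 g w); first exact: (xgetPex 0 (ex_intro _ p pmin)).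
  rewrite /y /G /prox_grad_map scalerA mulfV ?invr_eq0//.
  by rewrite scale1r opprB addrC subrK.
clearbody c w.
have gy : g y \is a fin_num.
  have := ymin xs; rewrite -(fineK gxs) fin_numE; move: (gNy y).
  by case: (g y) => [r| |].
exists (fine (g y)); first by rewrite fineK.
move=> z s gz.
have := prox_objective_ineq gcvx (ltW c0) ymin (esym (fineK gy)) gz.
rewrite (wE y) (wE z).
have := fL x y; have := fmu x z; rewrite -/d.
have mz : 0 <= mu / 2 * enorm (z - x) ^+ 2.
  by rewrite mulr_ge0 ?sqr_ge0// divr_ge0.
(* The growth term around [y] produces the inner product with [G]; its [L / 2] part cancels the one
   in [wE z]. *)
have -> : c * enorm (z - y) ^+ 2 = L / 2 * enorm (z - x) ^+ 2
    - inner G (x - z) + (2 * L)^-1 * enorm G ^+ 2.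
  rewrite cE (_ : z - y = (z - x) + L^-1 *: G); last first.
    by rewrite /y opprB addrCA addrC.
  rewrite -[x - z]opprB !sqr_enorm; move: (z - x) (G) => e h.
  rewrite !innerE (innerC e h).
  by field.
lra.
Qed.

(** * Decrease of the Lyapunov function *)

(** [F k] stands for [phi (y k)] and [Fs] for the minimum; the proximal gradient inequality enters
    only through its cases [z = xs] and [z = y k]. *)
Lemma lyapunov_le (R : realType) (n : nat) (L : R) (a b B F : nat -> R)
    (x y v G : nat -> 'rV[R]_n) (xs : 'rV[R]_n) (Fs : R) :
  0 < L -> (forall k, 0 < B k) -> b 0%N = B 0%N -> B 0%N <= 1 ->
  (forall k, 0 <= b k) ->
  (forall k, b k.+1 = B k.+1 - B k) ->
  (forall k, a k.+1 <= (B k.+1 - b k.+1 ^+ 2) / (2 * L)) ->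
  v 0%N = x 0%N ->
  (forall k, v k.+1 = v k - (b k / L) *: G k) ->
  (forall k, x k.+1 = (B k / B k.+1) *: y k + (b k.+1 / B k.+1) *: v k.+1) ->
  Fs <= F 0%N ->
  (forall k,
     F k <= Fs + inner (G k) (x k - xs) - (2 * L)^-1 * enorm (G k) ^+ 2) ->
  (forall k, F k.+1 <= F k + inner (G k.+1) (x k.+1 - y k)
                       - (2 * L)^-1 * enorm (G k.+1) ^+ 2) ->
  forall k,
    \sum_(0 <= i < k.+1) a i * enorm (G i) ^+ 2 + B k * (F k - Fs)
      + L / 2 * enorm (xs - v k.+1) ^+ 2
    <= a 0%N * enorm (G 0%N) ^+ 2 + b 0%N * (F 0%N - Fs)
      + L / 2 * enorm (xs - v 0%N) ^+ 2.
Proof.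
move=> L0 B_gt0 b0 B01 b_ge0 bS aS v0 vS xS FsF0 Fopt Fdec.
have Ln0 : L != 0 by rewrite gt_eqF.
have vE k : L / 2 * enorm (xs - v k.+1) ^+ 2 =
    L / 2 * enorm (xs - v k) ^+ 2 + b k * inner (G k) (xs - v k)
    + b k ^+ 2 * ((2 * L)^-1 * enorm (G k) ^+ 2).
  rewrite vS (_ : xs - _ = (xs - v k) + (b k / L) *: G k); last first.
    by rewrite opprB addrCA addrC.
  rewrite !sqr_enorm; move: (xs - v k) => e.
  rewrite !innerE (innerC e).
  by field.
elim=> [|k IHk].
  rewrite big_nat1 vE -b0 v0.
  have h : 0 <= inner (G 0%N) (x 0%N - xs) - (2 * L)^-1 * enorm (G 0%N) ^+ 2.
    have := Fopt 0%N; lra.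
  have Q0 : 0 <= (2 * L)^-1 * enorm (G 0%N) ^+ 2.
    by rewrite mulr_ge0 ?sqr_ge0// invr_ge0 mulr_ge0// ltW.
  have := mulr_ge0 (b_ge0 0%N) h.
  (* The distance term costs [b 0 ^+ 2] times [|G 0|^2 / (2 L)], while [h] supplies [b 0] times it;
     [B 0 <= 1] makes this enough. *)
  have : 0 <= b 0%N * (1 - b 0%N) * ((2 * L)^-1 * enorm (G 0%N) ^+ 2).
    apply: mulr_ge0 => //; apply: mulr_ge0 => //.
    by rewrite b0 subr_ge0.
  rewrite -[xs - x 0%N]opprB innerNr.
  move: (inner _ _) (_ * enorm _ ^+ 2) => I Q.
  lra.
apply: le_trans IHk.
rewrite big_nat_recr//= [X in _ + X <= _]vE.
(* The weighted second arguments sum to zero, by the recursion for [x] and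
   [B k.+1 = B k + b k.+1]. *)
have xE : B k * inner (G k.+1) (x k.+1 - y k)
    + b k.+1 * inner (G k.+1) (x k.+1 - xs)
    + b k.+1 * inner (G k.+1) (xs - v k.+1) = 0.
  rewrite xS !innerE; have BE := bS k; have Bn0 := B_gt0 k.+1.
  have -> : B k = B k.+1 - b k.+1 by rewrite BE opprB addrC subrK.
  by field; rewrite gt_eqF.
have Q0 : 0 <= (2 * L)^-1 * enorm (G k.+1) ^+ 2.
  by rewrite mulr_ge0 ?sqr_ge0// invr_ge0 mulr_ge0// ltW.
(* The weighted cases release [B k.+1] times [|G|^2 / (2 L)]; the distance term consumes
   [b k.+1 ^+ 2] of it, and the new summand fits into the rest. *)
have aQ : a k.+1 * enorm (G k.+1) ^+ 2 <=
    (B k.+1 - b k.+1 ^+ 2) * ((2 * L)^-1 * enorm (G k.+1) ^+ 2).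
  by rewrite [leRHS]mulrA ler_wpM2r ?sqr_ge0.
have h1 := ler_wpM2l (ltW (B_gt0 k)) (Fdec k).
have h2 := ler_wpM2l (b_ge0 k.+1) (Fopt k.+1).
have BE : b k.+1 = B k.+1 - B k by [].
move: aQ h1 h2 xE {Q0}; rewrite BE.
move: (_ * enorm (G k.+1) ^+ 2) => Q.
lra.
Qed.

(** * Minimum against weighted sum, and the explicit weights *)

Lemma bigmin_mul_sum_le (R : realType) (k : nat) (c : R) (a h : nat -> R) :
  (forall i, 0 <= a i) -> (forall i, 0 <= h i) ->
  c <= \sum_(0 <= i < k) a i ->
  (\big[Num.min/h 0%N]_(0 <= i < k) h i) * c <= \sum_(0 <= i < k) a i * h i.
Proof.
move=> a_ge0 h_ge0 ca; set M := \big[_/_]_(_ <= i < _) _.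
have M_ge0 : 0 <= M 
  by apply: (big_ind (fun u => 0 <= u)) => // u w u0 w0; rewrite le_min u0 w0.
apply: le_trans (ler_wpM2l M_ge0 ca) _.
rewrite mulr_sumr; apply: ler_sum_nat => i /andP[_ ik].
rewrite mulrC ler_wpM2l// /M big_mkord.
exact: (bigmin_le _ (Ordinal ik)).
Qed.

(** Of [a 0] only the sign is known. The term [a 1] alone attains the bound at [k = 0], and each
    later term exceeds the increment of the left side. *)
Lemma sum_explicit_weights_ge (R : realType) (L : R) (a : nat -> R) (k : nat) :
  0 < L -> 0 <= a 0%N ->
  (forall i, a i.+1 = i.+2%:R ^+ 2 / (32 * L)) ->
  k.+2%:R * k.+3%:R * k.+4%:R / (192 * L) <= \sum_(0 <= i < k.+2) a i.
Proof.
move=> L0 a0 aE.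
have Ln0 : L != 0 by rewrite gt_eqF.
elim: k => [|k IHk].
  rewrite big_nat_recr//= big_nat1 aE.
  rewrite (_ : _ * _ / _ = 2 ^+ 2 / (32 * L)) ?lerDr//.
  by field.
rewrite big_nat_recr//= aE; apply: le_trans (lerD IHk (lexx _)).
rewrite -subr_ge0.
rewrite (_ : _ - _ = k.+2%:R * k.+3%:R / (64 * L)).
  by rewrite !mulr_ge0// invr_ge0 mulr_ge0// ltW.
by rewrite -!natr1; field.
Qed.

(** * The general and explicit estimates *)

Unset Implicit Arguments.

(* The guard [B 0 <= 1] is needed for the general estimates: with n = 1, L = 1,
   f = 0, g = `|.|, x 0 = 1, B 0 = 100 and B k = 110 for k >= 1, both fail at
   k = 1.  The explicit parameters force B 0 = 1 / 4, so no guard there. *)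
Theorem theorem4p2 (R : realType) (n : nat) (mu L : R) (hL : 0 < L)
    (hmu : 0 <= mu)
    (f : 'rV[R]_n -> R) (hf : smooth_strongly_convex mu L f)
    (g : 'rV[R]_n -> \bar R) (hg : Gamma0 g)
    (xs : 'rV[R]_n) (hxs : argmin (composite f g) xs)
    (a b B : nat -> R)
    (hB : forall k, 0 < B k)
    (hb0 : b 0%N = B 0%N)
    (hb : forall k, (1 <= k)%N -> b k = B k - B k.-1)
    (ha_ge0 : forall k, 0 <= a k)
    (hb_ge0 : forall k, 0 <= b k)
    (ha : forall k, (1 <= k)%N -> a k <= (B k - b k ^+ 2) / (2 * L))
    (x y v : nat -> 'rV[R]_n)
    (hv0 : v 0%N = x 0%N)
    (hy : forall k, (1 <= k)%N ->
       y k.-1 = x k.-1 - L^-1 *: prox_grad_map f g (x k.-1) L^-1)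
    (hv : forall k, (1 <= k)%N ->
       v k = v k.-1 - (b k.-1 / L) *: prox_grad_map f g (x k.-1) L^-1)
    (hx : forall k, (1 <= k)%N ->
       x k = (B k.-1 / B k) *: y k.-1 + (b k / B k) *: v k) :
  let phi := composite f g in
  let phibar := min_value phi in
  let G := fun z => prox_grad_map f g z L^-1 in
  let C := ((a 0%N * enorm (G (x 0%N)) ^+ 2)%:E
            + (b 0%N)%:E * (phi (y 0%N) - phibar)
            + (L / 2 * enorm (xs - v 0%N) ^+ 2)%:E)%E in
  (B 0%N <= 1 ->
   forall k, (1 <= k)%N ->
     (phi (y k) - phibar <= C * ((B k)^-1)%:E)%E /\
     ((\sum_(0 <= i < k.+1) a i * enorm (G (x i)) ^+ 2)%R%:E <= C)%E)
  /\
  ((forall k, (1 <= k)%N ->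
      [/\ b k = (k.+1)%:R / 4,
          B k = (k.+1)%:R * (k.+2)%:R / 8
        & a k = (k.+1)%:R ^+ 2 / (32 * L)]) ->
   forall k, (1 <= k)%N ->
     (phi (y k) - phibar <= C * (8 / ((k.+1)%:R * (k.+2)%:R))%:E)%E /\
     ((\big[Num.min/(enorm (G (x 0%N)) ^+ 2)]_(0 <= i < k.+1)
         enorm (G (x i)) ^+ 2)%:E
      <= C * (192 * L / ((k.+1)%:R * (k.+2)%:R * (k.+3)%:R))%:E)%E).
Proof.
move=> phi phibar G C.
have [gpr _ _] := hg.
have gxs := fin_num_argmin_composite gpr hxs.
pose F k := f (y k) + fine (g (y k)); pose Fs := f xs + fine (g xs).
(* Finiteness of [g] at each [y k] reduces everything to the real sequence [F]. Taking [z = xs] and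
   [z = y j] gives [opt] and [dec] below. *)
have step k : g (y k) = (fine (g (y k)))%:E /\ forall z s, g z = s%:E ->
    F k <= f z + s + inner (G (x k)) (x k - z)
           - (2 * L)^-1 * enorm (G (x k)) ^+ 2.
  have [r gr ineq] := prox_grad_step (x k) hL hmu hf hg hxs.
  by rewrite /F (hy k.+1 isT) gr; split.
have phi_xs : phi xs = Fs%:E by rewrite /phi /composite -(fineK gxs) -EFinD.
have phi_y k : phi (y k) = (F k)%:E.
  by rewrite /phi /composite (step k).1 -EFinD.
have gapE k : (phi (y k) - phibar)%E = (F k - Fs)%:E.
  by rewrite /phibar (min_value_argmin hxs) -/phi phi_xs phi_y.
have gap_ge0 k : 0 <= F k - Fs.
  by rewrite subr_ge0 -lee_fin -phi_y -phi_xs; exact: hxs.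
pose C0 := a 0%N * enorm (G (x 0%N)) ^+ 2 + b 0%N * (F 0%N - Fs)
           + L / 2 * enorm (xs - v 0%N) ^+ 2.
have CE : C = C0%:E by rewrite /C gapE -EFinM -!EFinD.
have lyap : B 0%N <= 1 -> forall k,
    B k * (F k - Fs) <= C0 /\
    \sum_(0 <= i < k.+1) a i * enorm (G (x i)) ^+ 2 <= C0.
  move=> B01 k.
  have opt j : F j <= Fs + inner (G (x j)) (x j - xs)
                      - (2 * L)^-1 * enorm (G (x j)) ^+ 2.
    exact: (step j).2 _ _ (esym (fineK gxs)).
  have dec j : F j.+1 <= F j + inner (G (x j.+1)) (x j.+1 - y j)
                         - (2 * L)^-1 * enorm (G (x j.+1)) ^+ 2.
    exact: (step j.+1).2 _ _ (step j).1.
  have Fs_le : Fs <= F 0%N by rewrite -subr_ge0.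
  have := lyapunov_le hL hB hb0 B01 hb_ge0 (fun j => hb j.+1 isT)
    (fun j => ha j.+1 isT) hv0 (fun j => hv j.+1 isT) (fun j => hx j.+1 isT)
    Fs_le opt dec k.
  rewrite -/C0 => hk.
  have S0 : 0 <= \sum_(0 <= i < k.+1) a i * enorm (G (x i)) ^+ 2.
    by apply: sumr_ge0 => i _; rewrite mulr_ge0 ?sqr_ge0.
  have D0 : 0 <= B k * (F k - Fs) by rewrite mulr_ge0// ltW.
  have E0 : 0 <= L / 2 * enorm (xs - v k.+1) ^+ 2.
    by rewrite mulr_ge0 ?sqr_ge0// divr_ge0// ltW.
  by split; lra.
split=> [B01 k _|hex].
  have [hF hS] := lyap B01 k.
  by rewrite gapE CE -EFinM !lee_fin ler_pdivlMr// mulrC.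
(* [B 0 = B 1 - b 1 = 3 / 4 - 1 / 2]. *)
have B01 : B 0%N <= 1.
  have [b1 B1 _] := hex 1%N isT; have := hb 1%N isT; rewrite b1 B1 /=.
  lra.
(* The index is at least 1; written [k.+1], it matches the [k.+2] summands of
   [sum_explicit_weights_ge]. *)
case=> // k _; have [hF hS] := lyap B01 k.+1.
have [_ BE _] := hex k.+1 isT.
rewrite gapE CE -!EFinM !lee_fin; split.
  by rewrite -invf_div -BE ler_pdivlMr// mulrC.
rewrite -invf_div ler_pdivlMr; last by rewrite divr_gt0 ?mulr_gt0.
apply: le_trans hS; apply: bigmin_mul_sum_le => // [i|].
  exact: sqr_ge0.
apply: sum_explicit_weights_ge => // i.
by have [_ _ ->] := hex i.+1 isT.
Qed.
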